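(* Consider a discrete-time three-state hidden Markov model with 1-step transition probability matrix $P$ and state-dependent probability matrix $\Pi$. If the rank of $\Pi$ is $2$ and $0$ is an eigenvalue of $P$, then the observed process is reversible.
   Context: Discrete-time three-state hidden Markov model: $\{C_t:t\in\mathbb{Z}^+\}$ (times $0,1,2,\dots$) is an irreducible, time-homogeneous Markov chain on $\{1,2,3\}$ with 1-step transition probability matrix $P=(p_{ij})$, started from its stationary distribution $\mu=(\mu_1,\mu_2,\mu_3)$, $\mu_i>0$, $\sum_i\mu_i=1$. The state-dependent probability matrix $\Pi=(\pi(k\,|\,i))$, $i=1,2,3$, $k=0,\dots,K-1$, is a $3\times K$ matrix with nonnegative entries and rows summing to 1; $\varphi_k\in\mathbb{R}^3$ is its column indexed by $k$. The observed process $\{S_t\}$ takes values in $\{0,\dots,K-1\}$; conditionally on the hidden state at time $t$, $S_t$ has law $\pi(\cdot\,|\,C_t)$ and is independent of all earlier observations and of the hidden chain before time $t$. Thus for integers $0\le t_1<\cdots<t_n$, $\Pr(S_{t_1}=s_1,\dots,S_{t_n}=s_n)=\mu\Lambda_{s_1}P^{t_2-t_1}\Lambda_{s_2}\cdots P^{t_n-t_{n-1}}\Lambda_{s_n}\vec e$, where $\Lambda_k=\mathrm{diag}(\varphi_k)$, $\vec e=(1,1,1)'$. The observed process is reversible if for all positive integers $n$, all integers $0\le t_1\le\cdots\le t_n$ and all $s_1,\dots,s_n$, $\Pr(S_{t_1}=s_1,\dots,S_{t_n}=s_n)=\Pr(S_{t_1^-}=s_1,\dots,S_{t_n^-}=s_n)$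 with $t_k^-=t_1+t_n-t_k$. *)

(* Defs.v *)
From HB Require Import structures.
From mathcomp Require Import all_boot all_order all_algebra.
From mathcomp Require Import all_classical all_reals all_analysis.

Set Implicit Arguments.
Unset Strict Implicit.
Unset Printing Implicit Defensive.

Import Order.TTheory GRing.Theory Num.Theory.

Local Open Scope classical_set_scope.
Local Open Scope ring_scope.

Definition row_stochastic (R : realType) (m n : nat) (A : 'M[R]_(m, n)) : Prop :=
  (forall i j, 0 <= A i j) /\ (forall i, \sum_(j < n) A i j = 1).

Definition irreducible_chain (R : realType) (m : nat) (P : 'M[R]_m) : Prop :=
  forall i j, exists n : nat, 0 < (P ^+ n) i j.

Definition positive_stationary (R : realType) (m : nat) (P : 'M[R]_m)
    (mu : 'rV[R]_m) : Prop :=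
  [/\ forall i, 0 < mu 0 i, \sum_(i < m) mu 0 i = 1 & mu *m P = mu].

(* [agree X x n] is the event X_0 = x_0, ..., X_(n-1) = x_(n-1); it is the whole
   space when n = 0. *)
Definition agree (T A : Type) (X : nat -> T -> A) (x : nat -> A) (n : nat) :
    set T :=
  [set w | forall u, (u < n)%N -> X u w = x u].

(* Conditional laws are written in product form, so that histories of
   probability 0 impose nothing.
   [hmm_transition]: given the hidden states and the observations up to time t,
   the law of C_(t+1) is row C_t of P; in particular C is a Markov chain.
   [hmm_emission]: given the hidden states up to time t and the observations
   before time t, the law of S_t is row C_t of Pi. *)
Record three_state_hmm (R : realType) (d : measure_display)
    (T : measurableType d) (Pr : probability T R) (K : nat)
    (P : 'M[R]_3) (Pi : 'M[R]_(3, K)) (mu : 'rV[R]_3)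
    (C : nat -> T -> 'I_3) (S : nat -> T -> 'I_K) : Prop := ThreeStateHMM {
  hmm_P_stochastic : row_stochastic P;
  hmm_P_irreducible : irreducible_chain P;
  hmm_mu_stationary : positive_stationary P mu;
  hmm_Pi_stochastic : row_stochastic Pi;
  hmm_C_measurable : forall t i, measurable (C t @^-1` [set i]);
  hmm_S_measurable : forall t k, measurable (S t @^-1` [set k]);
  hmm_initial : forall i, Pr (C 0%N @^-1` [set i]) = (mu 0 i)%:E;
  hmm_transition : forall (t : nat) (c : nat -> 'I_3) (s : nat -> 'I_K),
    Pr (agree C c t.+2 `&` agree S s t.+1) =
    (Pr (agree C c t.+1 `&` agree S s t.+1) * (P (c t) (c t.+1))%:E)%E;
  hmm_emission : forall (t : nat) (c : nat -> 'I_3) (s : nat -> 'I_K),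
    Pr (agree C c t.+1 `&` agree S s t.+1) =
    (Pr (agree C c t.+1 `&` agree S s t) * (Pi (c t) (s t))%:E)%E
}.

(* A positive number of times is indexed by 'I_n.+1.  The truncated subtraction
   is exact because t is nondecreasing. *)
Definition reversible_process (R : realType) (d : measure_display)
    (T : measurableType d) (Pr : probability T R) (A : Type)
    (S : nat -> T -> A) : Prop :=
  forall (n : nat) (t : 'I_n.+1 -> nat) (s : 'I_n.+1 -> A),
    (forall i j : 'I_n.+1, (i <= j)%N -> (t i <= t j)%N) ->
    Pr [set w | forall k, S (t k) w = s k] =
    Pr [set w | forall k, S (t ord0 + t ord_max - t k)%N w = s k].

(* Main.v *)
Require Import Defs.
From HB Require Import structures.
From mathcomp Require Import all_boot all_order all_algebra.
From mathcomp Require Import all_classical all_reals all_analysis.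

Set Implicit Arguments.
Unset Strict Implicit.
Unset Printing Implicit Defensive.
Import Order.TTheory GRing.Theory Num.Theory.

Local Open Scope ring_scope.

(** Write e for the column of ones, and for a set F of symbols let
    Lambda_F be the diagonal matrix of the probabilities Pi(F | i).

    Each of the two hypotheses splits off a rank-one term.  As P e = e,
    mu P = mu and P is singular, P - e mu has rank at most 1, so
    P = e mu + x y with mu x = 0 and y e = 0 ([stationary_rank2_split]).  As Pi
    has rank 2 and its rows sum to 1, Pi = e a + v b for a column v and rows
    a, b ([deflate_rank2]); hence every Lambda_F has the form
    alpha_F I + beta_F V with one common V = diag(v).

    Factoring P through the plane with coordinates (mu, y) turns
    mu Lambda_{F_0} P Lambda_{F_1} P ... e into the corner entry of a product
    of 2 x 2 matrices with off-diagonal entries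
    mu Lambda_F x = beta_F (mu V x) and y Lambda_F e = beta_F (y V e).  These
    are the same multiple beta_F of two constants, so one diagonal change of
    basis, which does not touch the corner, turns every factor into its
    transpose (when a constant vanishes, the corner is just the product of the
    corners).  Transposing reverses the order of the factors
    ([corner_prod_rev], [forward_rev]).

    On the probabilistic side, a joint event about the times t_1, ..., t_n is an
    event that restricts S_u to a set F_u at every u of the window 0, ..., N,
    where N = t_1 + t_n and F_u is the whole alphabet at unobserved times.  This
    avoids powers of P, deals with repeated times, and makes time reversal the
    reflection u |-> N - u of the window.  Such an event has the probability
    mu Lambda_{F_0} P ... Lambda_{F_N} P e ([prob_constrained]). *)

(** * Rank-one perturbations *)

Lemma rank_le1_factor (F : fieldType) m n (A : 'M[F]_(m, n)) :
  (\rank A <= 1)%N -> exists (x : 'cV[F]_m) (y : 'rV[F]_n), A = x *m y.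
Proof.
(* Generalizing the rank lets the two possible values fix the matrix sizes. *)
move=> rk; move: (col_base A) (row_base A) (mulmx_base A).
case: (\rank A) rk => [|[|//]] _ c r <-; last by exists c, r.
by exists 0, 0; rewrite mulmx0 flatmx0 mulmx0.
Qed.

(** The projection 1 - e mu kills e, which lies in the column space of A, so
    applying it to A lowers the rank. *)
Lemma deflate_rank2 (F : fieldType) m n (A : 'M[F]_(m, n)) (mu : 'rV[F]_m)
    (e : 'cV[F]_m) (z : 'cV[F]_n) :
    mu *m e = 1%:M -> A *m z = e -> (\rank A <= 2)%N ->
  exists (x : 'cV[F]_m) (y : 'rV[F]_n), A = e *m (mu *m A) + x *m y.
Proof.
move=> mue Az rkA.
have [x [y Exy]] : exists (x : 'cV[F]_m) (y : 'rV[F]_n),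
    (1%:M - e *m mu) *m A = x *m y.
  apply: rank_le1_factor.
  rewrite -mxrank_tr trmx_mul -ltnS; apply: leq_trans rkA.
  rewrite -(mxrank_tr A) -(mxrank_mul_ker A^T (1%:M - e *m mu)^T).
  rewrite -addn1 leq_add2l.
  apply: (@leq_trans (\rank e^T)).
    rewrite lt0n mxrank_eq0; apply/eqP => e0.
    move: mue; rewrite -[e]trmxK e0 trmx0 mulmx0 => /matrixP/(_ 0 0)/eqP.
    by rewrite !mxE /= eq_sym oner_eq0.
  apply: mxrankS; rewrite sub_capmx -{1}Az trmx_mul submxMl /=.
  apply/sub_kermxP.
  by rewrite -trmx_mul mulmxBl mul1mx -mulmxA mue mulmx1 subrr trmx0.
exists x, y.
by rewrite -Exy mulmxBl mul1mx mulmxA addrC subrK.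
Qed.

(** Deflating P gives x and y with x y = P - e mu.  This product is unchanged
    by multiplying it by 1 - e mu on either side, so x and y can be replaced by
    their projections, which are orthogonal to mu and e even when x y = 0. *)
Lemma stationary_rank2_split (F : fieldType) m (P : 'M[F]_m) (mu : 'rV[F]_m)
    (e : 'cV[F]_m) :
    mu *m e = 1%:M -> mu *m P = mu -> P *m e = e -> (\rank P <= 2)%N ->
  exists (x : 'cV[F]_m) (y : 'rV[F]_m),
    [/\ P = e *m mu + x *m y, mu *m x = 0 & y *m e = 0].
Proof.
move=> mue muP Pe rkP.
have [x [y Exy]] := deflate_rank2 mue Pe rkP.
rewrite muP in Exy.
have xyE : x *m y = P - e *m mu by rewrite {1}Exy addrC addKr.
have muxy : mu *m (x *m y) = 0.
  by rewrite xyE mulmxBr muP mulmxA mue mul1mx subrr.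
have xye : x *m y *m e = 0.
  by rewrite xyE mulmxBl Pe -mulmxA mue mulmx1 subrr.
exists (x - e *m (mu *m x)), (y - (y *m e) *m mu); split.
- have x'y : (x - e *m (mu *m x)) *m y = x *m y.
    by rewrite mulmxBl -!mulmxA muxy mulmx0 subr0.
  rewrite mulmxBr x'y (mulmxA _ (y *m e)) (mulmxA _ y e) x'y xye.
  by rewrite mul0mx subr0.
- by rewrite mulmxBr (mulmxA mu e) mue mul1mx subrr.
- by rewrite mulmxBl -(mulmxA _ mu) mue mulmx1 subrr.
Qed.

(** * Reversing products of 2 x 2 matrices *)

Lemma prod_intertwine (S : nzRingType) (Z : S) (A B : nat -> S) n :
  (forall u, A u * Z = Z * B u) ->
  (\prod_(u < n) A u) * Z = Z * \prod_(u < n) B u.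
Proof.
move=> AZ; elim: n => [|n IHn]; first by rewrite !big_ord0 mulr1 mul1r.
by rewrite !big_ord_recr /= -mulrA AZ mulrA IHn mulrA.
Qed.

Lemma trmx_prod (R : comNzRingType) m (B : nat -> 'M[R]_m.+1) n :
  (\prod_(u < n) B u)^T = \prod_(u < n) (B (n.-1 - u)%N)^T.
Proof.
elim: n => [|n IHn]; first by rewrite !big_ord0 trmx1.
rewrite big_ord_recr big_ord_recl /= subn0 -mulmxE trmx_mul IHn.
congr (_ *m _); apply: eq_bigr => u _.
by rewrite /bump /= add1n -subn1 -subnDA add1n.
Qed.

Section Corner.
Variable R : comNzRingType.

(** Size [1 + 1] makes the block-matrix lemmas apply. *)
Definition corner_row : 'rV[R]_(1 + 1) := row_mx 1%:M 0.

Definition corner (M : 'M[R]_(1 + 1)) : 'M[R]_1 :=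
  corner_row *m M *m corner_row^T.

Definition scalar_block (p b c q : R) : 'M[R]_(1 + 1) :=
  block_mx p%:M b%:M c%:M q%:M.

Lemma tr_scalar_block p b c q : (scalar_block p b c q)^T = scalar_block p c b q.
Proof. by rewrite /scalar_block tr_block_mx !tr_scalar_mx. Qed.

Lemma mul_scalar_block p b c q p' b' c' q' :
  scalar_block p b c q *m scalar_block p' b' c' q' =
  scalar_block (p * p' + b * c') (p * b' + b * q')
               (c * p' + q * c') (c * b' + q * q').
Proof. by rewrite /scalar_block mulmx_block -!scalar_mxM -!raddfD. Qed.

Lemma corner_row_diag z : corner_row *m scalar_block 1 0 0 z = corner_row.
Proof.
rewrite /corner_row /scalar_block mul_row_block !mul0mx !mul1mx !addr0.
by rewrite raddf0.
Qed.

Lemma diag_corner_col z : scalar_block 1 0 0 z *m corner_row^T = corner_row^T.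
Proof.
by rewrite -[LHS]trmxK trmx_mul tr_scalar_block trmxK corner_row_diag.
Qed.

Lemma cornerMdiag M z : corner (M *m scalar_block 1 0 0 z) = corner M.
Proof. by rewrite /corner mulmxA -mulmxA diag_corner_col. Qed.

Lemma corner_diagM M z : corner (scalar_block 1 0 0 z *m M) = corner M.
Proof. by rewrite /corner mulmxA corner_row_diag. Qed.

Lemma corner_tr M : corner M^T = corner M.
Proof.
rewrite [in RHS](mx11_scalar (corner M)) -[in RHS]tr_scalar_mx -mx11_scalar.
by rewrite /corner !trmx_mul trmxK mulmxA.
Qed.

(** Intertwining with Z = diag(1, be) or W = diag(1, al) moves both off-diagonal
    constants to one side of the diagonal: A Z = Z B and B^T W = W A, where B has
    off-diagonal entries b al be and b.  Neither diagonal matrix changes the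
    corner, and B^T gives the reversed product; using two one-sided
    rescalings in place of a symmetrization avoids dividing by al and be, which
    may vanish. *)
Lemma corner_prod_rev (p b q : nat -> R) (al be : R) n :
  let A u := scalar_block (p u) (b u * al) (b u * be) (q u) in
  corner (\prod_(u < n) A u) = corner (\prod_(u < n) A (n.-1 - u)%N).
Proof.
move=> A.
pose B u := scalar_block (p u) (b u * (al * be)) (b u) (q u).
have AZ u : A u * scalar_block 1 0 0 be = scalar_block 1 0 0 be * B u.
  rewrite -mulmxE !mul_scalar_block.
  by congr scalar_block; rewrite ?mulr0 ?mul0r ?mulr1 ?mul1r ?addr0 ?add0r
    ?mulrA // mulrC.
have WA u : (B u)^T * scalar_block 1 0 0 al = scalar_block 1 0 0 al * A u.
  rewrite tr_scalar_block -mulmxE !mul_scalar_block.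
  congr scalar_block; rewrite ?mulr0 ?mul0r ?mulr1 ?mul1r ?addr0 ?add0r //.
    by rewrite mulrCA.
  by rewrite mulrC.
rewrite -[LHS](cornerMdiag _ be) mulmxE (prod_intertwine n AZ).
rewrite -mulmxE corner_diagM.
rewrite -corner_tr trmx_prod -(cornerMdiag _ al) mulmxE.
by rewrite (prod_intertwine n (fun u => WA (n.-1 - u)%N)) -mulmxE corner_diagM.
Qed.

End Corner.

(** * The forward recursion and its reversal *)

Section Forward.
Variables (R : comNzRingType) (m : nat).

(** With L u the diagonal matrix of emission probabilities at time u, entry j is
    the probability that the hidden state at time n is j and that the
    observations at times 0, ..., n - 1 satisfy their constraints
    ([prob_constrained_state]). *)
Fixpoint forward (mu : 'rV[R]_m) (P : 'M[R]_m) (L : nat -> 'M[R]_m) (n : nat) :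
    'rV[R]_m :=
  if n is n'.+1 then forward mu P L n' *m L n' *m P else mu.

(** With U the matrix of rows mu, y and X that of columns e, x, one has P = X U,
    so the 3-dimensional recursion is carried by the 2 x 2 matrices U L X, to
    which [corner_prod_rev] applies. *)
Lemma forward_rev (mu : 'rV[R]_m) (P V : 'M[R]_m) (e x : 'cV[R]_m)
    (y : 'rV[R]_m) (a b : nat -> R) n :
    mu *m e = 1%:M -> P = e *m mu + x *m y -> mu *m x = 0 -> y *m e = 0 ->
  let L u := (a u)%:M + b u *: V in
  forward mu P L n *m e = forward mu P (fun u => L (n.-1 - u)%N) n *m e.
Proof.
move=> mue PE mux ye L.
pose U := col_mx mu y; pose X := row_mx e x.
pose A u := scalar_block (a u + b u * (mu *m V *m e) 0 0)
  (b u * (mu *m V *m x) 0 0) (b u * (y *m V *m e) 0 0)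
  (a u * (y *m x) 0 0 + b u * (y *m V *m x) 0 0).
have PXU : P = X *m U by rewrite /X /U mul_row_col.
have ULX u : U *m L u *m X = A u.
  rewrite /U /X mul_col_mx mul_col_row /L !mulmxDr !mulmxDl.
  rewrite !mul_mx_scalar -!scalemxAr -!scalemxAl mue mux ye.
  rewrite /A /scalar_block !scaler0 !add0r.
  by congr block_mx; rewrite ?raddfD /= ?scalar_mxM mul_scalar_mx;
    rewrite -?mx11_scalar ?mul_scalar_mx -?mx11_scalar ?scalemx1.
have fwdE (f : nat -> nat) k : forward mu P (fun u => L (f u)) k =
    corner_row R *m (\prod_(u < k) A (f u)) *m U.
  elim: k => [|k IHk] /=.
    by rewrite big_ord0 mulmx1 /corner_row /U mul_row_col mul1mx mul0mx addr0.
  rewrite IHk big_ord_recr /= -mulmxE -ULX PXU.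
  by rewrite !mulmxA.
have Ue : U *m e = (corner_row R)^T.
  by rewrite /U mul_col_mx mue ye /corner_row tr_row_mx trmx1 trmx0.
have := corner_prod_rev (fun u => a u + b u * (mu *m V *m e) 0 0) b
  (fun u => a u * (y *m x) 0 0 + b u * (y *m V *m x) 0 0)
  ((mu *m V *m x) 0 0) ((y *m V *m e) 0 0) n.
rewrite (fwdE id) (fwdE (fun u => n.-1 - u)%N) -!(mulmxA _ U) Ue.
exact.
Qed.

End Forward.

(** * Events determined by finite histories *)

Local Open Scope classical_set_scope.
Local Open Scope ring_scope.

Lemma measure_fin_fibers (R : realType) (d : measure_display)
    (T : measurableType d) (mu : {measure set T -> \bar R}) (Y : finType)
    (H : T -> Y) (p : pred Y) (B : set T) :
    (forall y, measurable (H @^-1` [set y])) -> measurable B ->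
  (mu ([set w | p (H w)] `&` B) =
     \sum_(y | p y) mu (H @^-1` [set y] `&` B))%E.
Proof.
move=> mH mB.
have -> : [set w | p (H w)] `&` B =
    \bigcup_(y in [set y | p y]) (H @^-1` [set y] `&` B).
  apply/seteqP; split=> w /=; first by case=> pw Bw; exists (H w).
  by case=> y /= py [Hw Bw]; rewrite Hw.
rewrite measure_fin_bigcup //.
- by rewrite [RHS]bigfs ?index_enum_uniq // => y; rewrite mem_index_enum.
- exact: finite_finset.
- by move=> y z _ _ [w [[/= <- _] [/= <- _]]].
- by move=> y _; apply: measurableI.
Qed.

Lemma agreeS (T A : Type) (X : nat -> T -> A) x n :
  agree X x n.+1 = agree X x n `&` X n @^-1` [set x n].
Proof.
apply/seteqP; split=> w /=.
  by move=> h; split=> [u un|]; apply: h => //; exact: leqW.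
by case=> h hn u; rewrite ltnS leq_eqVlt => /predU1P [->//|]; apply: h.
Qed.

Lemma eq_agree (T A : Type) (X : nat -> T -> A) x y n :
  (forall u, (u < n)%N -> x u = y u) -> agree X x n = agree X y n.
Proof.
by move=> xy; apply/seteqP; split=> w /= h u un; rewrite h // xy.
Qed.

Lemma measurable_agree (d : measure_display)
    (T : measurableType d) (A : Type) (X : nat -> T -> A) x n :
  (forall t a, measurable (X t @^-1` [set a])) -> measurable (agree X x n).
Proof.
move=> mX.
have -> : agree X x n =
    \bigcap_(u in [set u | (u < n)%N]) (X u @^-1` [set x u]).
  by apply/seteqP; split=> w /= h u; apply: h.
by apply: bigcap_measurableType => u _; apply: mX.
Qed.

(** * Probabilities of constrained observations *)

Section HMM.
Context (R : realType) (d : measure_display)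
    (T : measurableType d) (Pr : probability T R) (K : nat)
    (P : 'M[R]_3) (Pi : 'M[R]_(3, K)) (mu : 'rV[R]_3)
    (C : nat -> T -> 'I_3) (S : nat -> T -> 'I_K)
    (hHMM : three_state_hmm Pr P Pi mu C S).

Definition constrained (F : nat -> pred 'I_K) (n : nat) : set T :=
  [set w | forall u, (u < n)%N -> F u (S u w)].

Definition at_state (t : nat) (i : 'I_3) : set T := C t @^-1` [set i].

(** The model prescribes conditional probabilities given a complete history of
    states and symbols.  They extend to every event A determined by the history,
    because A is a finite disjoint union of complete histories. *)
Lemma history_factor n m (A B : set T) (q : R) :
    (forall w w', agree C (C^~ w) n w' -> agree S (S^~ w) m w' ->
      A w -> A w') ->
    measurable B -> 0 <= q ->
    (forall w, A w ->
      Pr (agree C (C^~ w) n `&` agree S (S^~ w) m `&` B) =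
      (Pr (agree C (C^~ w) n `&` agree S (S^~ w) m) * q%:E)%E) ->
  Pr (A `&` B) = (Pr A * q%:E)%E.
Proof.
move=> detA mB q0 AB.
pose H w := ([ffun u : 'I_n => C u w], [ffun u : 'I_m => S u w]).
pose p := [pred y | `[< exists2 w, A w & H w = y >]].
have fiber w : H @^-1` [set H w] = agree C (C^~ w) n `&` agree S (S^~ w) m.
  apply/seteqP; split=> w' /=.
    case=> /ffunP hC /ffunP hS; split=> u un.
      by have := hC (Ordinal un); rewrite !ffunE.
    by have := hS (Ordinal un); rewrite !ffunE.
  by case=> hC hS; congr (_, _); apply/ffunP => u; rewrite !ffunE;
    [apply: hC | apply: hS].
(* A nonempty fiber is the history of one of its points, so no history needs to
   be extended by default values. *)
have mH y : measurable (H @^-1` [set y]).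
  have [[w <-]|Hy] := pselect (exists w, H w = y).
    rewrite fiber; apply: measurableI; apply: measurable_agree.
      exact: hmm_C_measurable hHMM.
    exact: hmm_S_measurable hHMM.
  suff -> : H @^-1` [set y] = set0 by exact: measurable0.
  by rewrite -subset0 => w /= Hw; apply: Hy; exists w.
have AE : A = [set w | p (H w)].
  apply/seteqP; split=> w /=; first by move=> Aw; apply/asboolP; exists w.
  move/asboolP => [w' Aw' Hw].
  have : (H @^-1` [set H w']) w by rewrite /= Hw.
  by rewrite fiber => -[hC hS]; apply: detA Aw'.
rewrite -[X in (_ = Pr X * _)%E]setIT AE !measure_fin_fibers //.
rewrite ge0_sume_distrl; last by move=> *; exact: measure_ge0.
apply: eq_bigr => y /asboolP [w Aw <-].
by rewrite setIT fiber; exact: AB.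
Qed.

Definition emission (F : pred 'I_K) : 'M[R]_3 :=
  diag_mx (\row_i \sum_(k | F k) Pi i k).

Lemma prob_transition F t i j :
  Pr (constrained F t.+1 `&` at_state t i `&` at_state t.+1 j) =
  (Pr (constrained F t.+1 `&` at_state t i) * (P i j)%:E)%E.
Proof.
apply: (@history_factor t.+1 t.+1).
- move=> w w' hC hS [hF hi]; split=> [u un|].
    by rewrite hS //; exact: hF.
  by rewrite /at_state /= hC.
- exact: hmm_C_measurable hHMM _ _.
- by have [] := hmm_P_stochastic hHMM.
move=> w [_ hi].
pose c u := if u == t.+1 then j else C u w.
have cE u : (u < t.+1)%N -> C u w = c u by move=> /ltn_eqF ut; rewrite /c ut.
have cj : c t.+1 = j by rewrite /c eqxx.
rewrite setIAC (eq_agree C cE).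
have -> : agree C c t.+1 `&` at_state t.+1 j = agree C c t.+2.
  by rewrite (agreeS _ _ t.+1) cj.
by rewrite (hmm_transition hHMM) -cE // cj hi.
Qed.

Lemma prob_emission F t i k :
  Pr (constrained F t `&` at_state t i `&` S t @^-1` [set k]) =
  (Pr (constrained F t `&` at_state t i) * (Pi i k)%:E)%E.
Proof.
apply: (@history_factor t.+1 t).
- move=> w w' hC hS [hF hi]; split=> [u un|].
    by rewrite hS //; exact: hF.
  by rewrite /at_state /= hC.
- exact: hmm_S_measurable hHMM _ _.
- by have [] := hmm_Pi_stochastic hHMM.
move=> w [_ hi].
pose s u := if u == t then k else S u w.
have sE u : (u < t)%N -> S u w = s u by move=> /ltn_eqF ut; rewrite /s ut.
have sk : s t = k by rewrite /s eqxx.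
rewrite -setIA (eq_agree S sE).
have -> : agree S s t `&` S t @^-1` [set k] = agree S s t.+1.
  by rewrite agreeS sk.
by rewrite (hmm_emission hHMM) sk hi.
Qed.

Lemma measurable_constrained F n : measurable (constrained F n).
Proof.
have -> : constrained F n =
    \bigcap_(u in [set u | (u < n)%N]) \bigcup_(k in [set k | F u k])
      (S u @^-1` [set k]).
  apply/seteqP; split=> w /= h u un; first by exists (S u w) => //=; exact: h.
  by have [k /= Fk ->] := h u un.
apply: bigcap_measurableType => u _; apply: fin_bigcup_measurable.
  exact: finite_finset.
by move=> k _; exact: hmm_S_measurable hHMM _ _.
Qed.

(** One step of the forward recursion: split over the state and the symbol at
    time n, then use the emission law for the symbol and the transition law for
    the next state. *)
Lemma prob_constrained_state F n j :
  Pr (constrained F n `&` at_state n j) =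
  (forward mu P (fun u => emission (F u)) n 0 j)%:E.
Proof.
have mC t i : measurable (at_state t i) := hmm_C_measurable hHMM t i.
elim: n j => [|n IHn] j.
  rewrite /= -(hmm_initial hHMM); congr (Pr _).
  by apply/seteqP; split=> w /=; [case | split].
rewrite -[X in Pr X]setTI.
have -> : [set: T] = [set w | predT (C n w)] by apply/seteqP; split.
rewrite measure_fin_fibers; [|exact: mC|
  exact: measurableI (measurable_constrained _ _) (mC _ _)].
rewrite /= mxE -sumEFin; apply: eq_bigr => i _.
rewrite setIC setIAC prob_transition EFinM; congr (_ * _)%E.
have -> : constrained F n.+1 `&` at_state n i =
    [set w | F n (S n w)] `&` (constrained F n `&` at_state n i).
  apply/seteqP; split=> w /=.
    by case=> h hi; split; [apply: h | split=> // u un; apply/h/leqW].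
  case=> hn [h hi]; split=> // u.
  by rewrite ltnS leq_eqVlt => /predU1P [->//|]; apply: h.
rewrite measure_fin_fibers; [|exact: hmm_S_measurable hHMM n|
  exact: measurableI (measurable_constrained _ _) (mC _ _)].
rewrite mul_mx_diag !mxE mulr_sumr -sumEFin.
apply: eq_bigr => k _; rewrite (setIC (S n @^-1` _)).
by apply: (etrans (prob_emission F n i k)); rewrite IHn EFinM.
Qed.

Lemma prob_constrained F n :
  Pr (constrained F n) =
  ((forward mu P (fun u => emission (F u)) n
      *m (const_mx 1 : 'cV_3)) 0 0)%:E.
Proof.
rewrite -[constrained F n]setTI.
have -> : [set: T] = [set w | predT (C n w)] by apply/seteqP; split.
rewrite measure_fin_fibers; [|exact: hmm_C_measurable hHMM n|
  exact: measurable_constrained].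
rewrite mxE -sumEFin; apply: eq_bigr => i _.
by rewrite setIC [const_mx _ _ _]mxE mulr1; exact: prob_constrained_state.
Qed.

(** Summing Pi = e (mu Pi) + v b over the allowed symbols shows that every
    emission matrix is alpha I + beta V with V = diag(v), the form that
    [forward_rev] asks for. *)
Lemma prob_constrained_rev F n :
    \rank Pi = 2%N -> eigenvalue P 0 ->
  Pr (constrained F n) = Pr (constrained (fun u => F (n.-1 - u)%N) n).
Proof.
move=> rkPi eigP; rewrite !prob_constrained; congr (fun_of_matrix _ 0 0)%:E.
pose e : 'cV[R]_3 := const_mx 1; rewrite -/e.
have [_ mu1 muP] := hmm_mu_stationary hHMM.
have [_ P1] := hmm_P_stochastic hHMM.
have [_ Pi1] := hmm_Pi_stochastic hHMM.
have mue : mu *m e = 1%:M.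
  apply/rowP => i; rewrite [i]ord1 !mxE /= -mu1.
  by apply: eq_bigr => k _; rewrite mxE mulr1.
have Pe : P *m e = e.
  apply/colP => i; rewrite !mxE -[RHS](P1 i).
  by apply: eq_bigr => k _; rewrite mxE mulr1.
have Pie : Pi *m const_mx 1 = e.
  apply/colP => i; rewrite !mxE -[RHS](Pi1 i).
  by apply: eq_bigr => k _; rewrite mxE mulr1.
have rkP : (\rank P <= 2)%N.
  have [v vP v0] := eigenvalueP eigP; rewrite scale0r in vP.
  rewrite -ltnS ltn_neqAle rank_leq_row andbT; apply: contra v0 => frP.
  by rewrite -(mulmx_free_eq0 v frP) vP.
have [x [y [PE mux ye]]] := stationary_rank2_split mue muP Pe rkP.
have rkPi2 : (\rank Pi <= 2)%N by rewrite rkPi.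
have [v [b PiE]] := deflate_rank2 mue Pie rkPi2.
pose V := diag_mx v^T.
pose al u := \sum_(k | F u k) (mu *m Pi) 0 k.
pose be u := \sum_(k | F u k) b 0 k.
have LE u : emission (F u) = (al u)%:M + be u *: V.
  rewrite /emission /V -diag_const_mx -linearZ -linearD; congr diag_mx.
  apply/rowP => i; rewrite !mxE /al /be mulr_suml -big_split /=.
  apply: eq_bigr => k _; rewrite {1}PiE.
  by rewrite mxE ![(_ *m _) i k]mxE !big_ord1 [e _ _]mxE mul1r mulrC.
have fLE (g : nat -> nat) : (fun u => emission (F (g u))) =
    fun u => (al (g u))%:M + be (g u) *: V.
  by apply/funext => u; exact: LE.
rewrite (fLE id) (fLE (fun u => n.-1 - u)%N).
exact: (forward_rev V al be n mue PE mux ye).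
Qed.

End HMM.

Theorem proposition4p6 (R : realType) (d : measure_display)
    (T : measurableType d) (Pr : probability T R) (K : nat)
    (P : 'M[R]_3) (Pi : 'M[R]_(3, K)) (mu : 'rV[R]_3)
    (C : nat -> T -> 'I_3) (S : nat -> T -> 'I_K)
    (hHMM : three_state_hmm Pr P Pi mu C S)
    (hrank : \rank Pi = 2%N)
    (heig : eigenvalue P 0) :
  reversible_process Pr S.
Proof.
move=> n t s t_mono.
(* The window 0, ..., N is symmetric under the time reversal of the process. *)
pose N := (t ord0 + t ord_max)%N.
pose F u : pred 'I_K := [pred x | [forall j, (t j == u) ==> (x == s j)]].
have tN j : (t j <= N)%N.
  by apply: leq_trans (leq_addl _ _); apply: t_mono; rewrite -ltnS.
have -> : [set w | forall k, S (t k) w = s k] = constrained S F N.+1.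
  apply/seteqP; split=> w /= h.
    by move=> u _; apply/forallP => j; apply/implyP => /eqP <-; rewrite h.
  by move=> j; have /forallP/(_ j) := h (t j) (tN j); rewrite eqxx => /eqP.
rewrite (prob_constrained_rev hHMM _ _ hrank heig) /=; congr (Pr _).
apply/seteqP; split=> w /= h.
  move=> j; have /forallP/(_ j) := h (N - t j)%N (leq_subr _ _).
  by rewrite subKn // eqxx => /eqP.
move=> u uN; apply/forallP => j; apply/implyP => /eqP tj.
by rewrite -(h j) tj subKn.
Qed.
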